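(* Let $\mathbb{K}$ be a field of characteristic zero, $s\ge 1$, and $l,n\in\mathbb{N}$. Let $\alpha=(\alpha_1^0,\ldots,\alpha_1^n,\ldots,\alpha_s^0,\ldots,\alpha_s^n)\in\mathbb{N}^{s(n+1)}$ be such that $0\leq\lambda_\alpha\leq l\leq n$, where $\lambda_\alpha=\sum_{i=1}^s\sum_{j=0}^n j\,\alpha_i^j$. Then the following identity holds as functions on the polynomial ring $\mathbb{K}[x_1,\ldots,x_s]$: $$\frac{\partial^{\alpha}}{\partial x^{\alpha}}\circ d_l=d_{l-\lambda_\alpha}\circ\frac{\partial^{\hat{\alpha}}}{\partial x^{\hat{\alpha}}},$$ where $\hat\alpha=\big(\sum_{j=0}^n\alpha_1^j,\ldots,\sum_{j=0}^n\alpha_s^j\big)\in\mathbb{N}^s$.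
   Context: For $A=\mathbb{K}[x_1,\ldots,x_s]$, the Hasse-Schmidt algebra of order $n$ over $\mathbb{K}$ is the polynomial ring $A_n=\mathbb{K}[x_i^{(j)}\mid 1\le i\le s,\ 0\le j\le n]$, where $x_i^{(0)}=x_i$. The universal Hasse-Schmidt derivation $(d_0,\ldots,d_n)$ from $A$ to $A_n$ consists of the $\mathbb{K}$-linear maps $d_l:A\to A_n$ determined by: $d_0$ is the inclusion of $\mathbb{K}$-algebras, $d_l(c)=0$ for $c\in\mathbb{K}$ and $l\geq1$, $d_l(x_i)=x_i^{(l)}$, and $d_l(fg)=\sum_{i+j=l}d_i(f)d_j(g)$. On the left-hand side, $\frac{\partial^\alpha}{\partial x^\alpha}$ is the iterated partial derivative on $A_n$ in which one differentiates $\alpha_i^j$ times with respect to $x_i^{(j)}$ for all $i,j$; on the right-hand side, $\frac{\partial^{\hat\alpha}}{\partial x^{\hat\alpha}}$ is the usual iterated partial derivative on $\mathbb{K}[x_1,\ldots,x_s]$. *)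

(* Defs.v *)
From HB Require Import structures.
From mathcomp Require Import all_boot all_order all_algebra.
From mathcomp Require Import mpoly.

Set Implicit Arguments.
Unset Strict Implicit.
Unset Printing Implicit Defensive.

Import GRing.Theory.

Local Open Scope ring_scope.

(* The variables x_i^(j) of the Hasse-Schmidt algebra
   {mpoly K[s * n.+1]} are numbered in row-major order
   x_1^(0), ..., x_1^(n), ..., x_s^(0), ..., x_s^(n).                      *)
Definition hs_index (s n : nat) (i : 'I_s) (j : 'I_n.+1) : 'I_(s * n.+1) :=
  mxvec_index i j.

(* Only d 0, ..., d n are constrained; the values d l for l > n are junk.
   These conditions determine d 0, ..., d n: see
   universal_HS_derivation_exists and universal_HS_derivation_unique.      *)
Record universal_HS_derivation (K : fieldType) (s n : nat)
    (d : nat -> {mpoly K[s]} -> {mpoly K[s * n.+1]}) : Prop :=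
  UniversalHSDerivation {
    HS_linear : forall l : nat, (l <= n)%N -> linear (d l);
    HS_incl : forall f : {mpoly K[s]},
      d 0%N f = f \mPo [tuple 'X_(hs_index i ord0) | i < s];
    HS_const : forall (l : nat) (c : K),
      (0 < l <= n)%N -> d l c%:MP = 0;
    HS_var : forall (j : 'I_n.+1) (i : 'I_s), d j 'X_i = 'X_(hs_index i j);
    HS_prod : forall (l : nat) (f g : {mpoly K[s]}), (l <= n)%N ->
      d l (f * g) = \sum_(i < l.+1) d i f * d (l - i)%N g
  }.

Definition hs_weight (s n : nat) (alpha : 'X_{1..s * n.+1}) : nat :=
  (\sum_(i < s) \sum_(j < n.+1) j * alpha (hs_index i j))%N.

Definition hs_hat (s n : nat) (alpha : 'X_{1..s * n.+1}) : 'X_{1..s} :=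
  [multinom (\sum_(j < n.+1) alpha (hs_index i j))%N | i < s].

(* d l f is the coefficient of T^l in f(\sum_j x_1^(j) T^j, ...).          *)
Lemma universal_HS_derivation_exists (K : fieldType) (s n : nat) :
  exists d, @universal_HS_derivation K s n d.
Proof.
pose An := {mpoly K[s * n.+1]}.
pose h : K -> {poly An} := polyC \o @mpolyC (s * n.+1) K.
pose y i : {poly An} := \poly_(j < n.+1) 'X_(hs_index i (inord j)).
pose phi : {mpoly K[s]} -> {poly An} := mmap h y.
have phiM f g : phi (f * g) = phi f * phi g by rewrite /phi rmorphM.
have phiC c : phi c%:MP = (c%:MP)%:P by rewrite /phi mmapC.
have phiX i : phi 'X_i = y i by rewrite /phi mmapX mmap1U.
have phiD f g : phi (f + g) = phi f + phi g by rewrite /phi rmorphD.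
have phi0 : phi 0 = 0 by rewrite /phi raddf0.
have phiXm m : phi 'X_[m] = \prod_(i < s) y i ^+ m i by rewrite /phi mmapX.
clearbody phi.
have phi0M f g : (phi (f * g))`_0 = (phi f)`_0 * (phi g)`_0.
  by rewrite phiM coefM big_ord1.
exists (fun l f => (phi f)`_l); split.
- move=> l _ c f g.
  by rewrite -mul_mpolyC phiD phiM phiC coefD coefCM mul_mpolyC.
- move=> f; elim/mpolyind: f => [|c m f _ _ /= IH] /=.
    by rewrite comp_mpoly0 phi0 coef0.
  rewrite phiD coefD IH comp_mpolyD; congr (_ + _).
  rewrite comp_mpolyZ -mul_mpolyC phi0M phiC coefC /= mul_mpolyC.
  congr (_ *: _); rewrite phiXm comp_mpolyX -horner_coef0 horner_prod.
  apply: eq_bigr => i _.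
  rewrite horner_exp horner_coef0 coef_poly tnth_mktuple /=.
  congr ('X_(hs_index _ _) ^+ _).
  by apply: val_inj; rewrite /= inordK.
- by move=> [|l] c // _; rewrite phiC coefC.
- by move=> j i; rewrite phiX coef_poly ltn_ord inord_val.
- by move=> l f g _; rewrite phiM coefM.
Qed.

Lemma universal_HS_derivation_unique (K : fieldType) (s n : nat)
    (d e : nat -> {mpoly K[s]} -> {mpoly K[s * n.+1]}) :
  universal_HS_derivation d -> universal_HS_derivation e ->
  forall l, (l <= n)%N -> d l =1 e l.
Proof.
move=> [dl d0 dC dX dM] [el e0 eC eX eM].
have agreeM f g : (forall l, (l <= n)%N -> d l f = e l f) ->
    (forall l, (l <= n)%N -> d l g = e l g) ->
    forall l, (l <= n)%N -> d l (f * g) = e l (f * g).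
  move=> Hf Hg l ln; rewrite dM // eM //; apply: eq_bigr => i _.
  by rewrite Hf ?Hg // (leq_trans _ ln) ?leq_subr // -ltnS.
have agreeC c l : (l <= n)%N -> d l c%:MP = e l c%:MP.
  by case: l => [|l] ln; rewrite ?d0 ?e0 // dC ?eC.
have agreeX i l : (l <= n)%N -> d l 'X_i = e l 'X_i.
  by move=> ln; rewrite (dX (Ordinal (ln : (l < n.+1)%N))) -eX.
move=> l ln f; elim/mpolyind: f l ln => [|c m f _ _ IH] l ln.
  by rewrite -mpolyC0 agreeC.
rewrite (dl l ln) (el l ln) IH //; congr (_ *: _ + _).
rewrite mpolyXE_id; move: l ln; elim/big_rec: _ => [|i p _ IHp].
  by move=> l ln; rewrite -mpolyC1 agreeC.
apply: (agreeM) => //; elim: (m i) => [|k IHk] l ln.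
  by rewrite expr0 -mpolyC1 agreeC.
by rewrite exprS; apply: (agreeM) => // ? ?; exact: agreeX.
Qed.

(* Main.v *)
Require Import Defs.
From mathcomp Require Import all_boot all_order all_algebra.
From mathcomp Require Import mpoly.

(** The universal derivation collects the Taylor coefficients of a polynomial
    along a generic arc: modulo T^(n+1),

      d_0 f + d_1 f T + ... + d_n f T^n = f(x_1(T), ..., x_s(T)),
      x_i(T) = x_i^(0) + x_i^(1) T + ... + x_i^(n) T^n.

    Since x_i^(j) occurs on the right only in x_i(T), with coefficient T^j,
    the chain rule says that differentiating with respect to x_i^(j)
    multiplies by T^j the series of the partial derivative of f in x_i.  The
    coefficient of T^l gives [mderiv_HS]: the derivative of d_l f with respect
    to x_i^(j) is d_(l-j) applied to the i-th partial derivative of f, and 0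
    when j > l.  It is proved from the axioms of d, without the series: both
    sides are linear in f and agree on constants and variables, and the Leibniz
    rules for d and for partial derivatives carry the agreement over to
    products, because shifting one factor of a convolution product shifts the
    product ([sum_shift_mul]).

    A general operator is a composite of one-variable derivatives.  The weight
    and the multi-index hat of alpha are additive, and the variable x_i^(j)
    contributes j to the weight and the i-th unit vector to the hat, so the
    theorem follows by induction on the total degree of alpha.  Along the
    induction the indices j removed add up to the weight, hence never exceed
    l, and the vanishing case of [mderiv_HS] is never met. *)

Set Implicit Arguments.
Unset Strict Implicit.
Unset Printing Implicit Defensive.

Import GRing.Theory.

Local Open Scope ring_scope.

(** The coefficient of T^l in the product of T^j F(T) and G(T). *)
Lemma sum_shift_mul (R : pzRingType) (F G : nat -> R) (j l : nat) :
  \sum_(a < l.+1) (if (j <= a)%N then F (a - j)%N else 0) * G (l - a)%N =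
  if (j <= l)%N then \sum_(a < (l - j).+1) F a * G (l - j - a)%N else 0.
Proof.
rewrite -(big_mkord xpredT
  (fun a => (if (j <= a)%N then F (a - j)%N else 0) * G (l - a)%N)).
have zero_below m : (m <= j)%N ->
    \sum_(0 <= a < m) (if (j <= a)%N then F (a - j)%N else 0) * G (l - a)%N = 0.
  move=> le_mj; rewrite big_nat big1 // => a /andP[_ lt_am].
  by rewrite leqNgt (leq_trans lt_am le_mj) mul0r.
case: leqP => [le_jl|]; last exact: zero_below.
rewrite (big_cat_nat (n := j)) ?leqW //= zero_below // add0r.
rewrite -{1}[j]add0n big_addn subSn // big_mkord; apply: eq_bigr => a _.
by rewrite leq_addl addnK addnC subnDA.
Qed.

(** Polynomials are generated as a ring by constants and variables, which is
    the form that suits rules for sums and products; [mpolyind] works with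
    monomials instead. *)
Lemma mpoly_alg_ind (R : comNzRingType) (n : nat) (P : {mpoly R[n]} -> Prop) :
  (forall c, P c%:MP) -> (forall i, P 'X_i) ->
  (forall p q, P p -> P q -> P (p + q)) ->
  (forall p q, P p -> P q -> P (p * q)) ->
  forall p, P p.
Proof.
move=> PC PX PD PM; elim/mpolyind => [|c m p _ _ Pp]; first exact: PC 0.
apply: (PD) => //; rewrite -mul_mpolyC; apply: (PM) => //.
have P1 : P 1 := PC 1.
rewrite mpolyXE_id; apply: (big_ind P) => // i _.
by elim: (m i) => [//|k IHk]; rewrite exprS; apply: (PM).
Qed.

Lemma eq_hs_index (s n : nat) (i i' : 'I_s) (j j' : 'I_n.+1) :
  (hs_index i j == hs_index i' j') = (i == i') && (j == j').
Proof.
rewrite -xpair_eqE; apply/eqP/eqP => [|[-> ->]] //.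
by move/cast_ord_inj/enum_rank_inj.
Qed.

Lemma hs_weight0 (s n : nat) : hs_weight (0%MM : 'X_{1..s * n.+1}) = 0%N.
Proof. by apply: big1 => i _; apply: big1 => j _; rewrite mnm0E muln0. Qed.

Lemma hs_hat0 (s n : nat) : hs_hat (0%MM : 'X_{1..s * n.+1}) = 0%MM.
Proof. by apply/mnmP => i; rewrite !mnmE big1 // => j _; rewrite mnm0E. Qed.

Lemma hs_weightD (s n : nat) (a b : 'X_{1..s * n.+1}) :
  hs_weight (a + b)%MM = (hs_weight a + hs_weight b)%N.
Proof.
rewrite /hs_weight -big_split; apply: eq_bigr => i _.
by rewrite -big_split; apply: eq_bigr => j _; rewrite mnmDE mulnDr.
Qed.

Lemma hs_hatD (s n : nat) (a b : 'X_{1..s * n.+1}) :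
  hs_hat (a + b)%MM = (hs_hat a + hs_hat b)%MM.
Proof.
apply/mnmP => i; rewrite !mnmE -big_split.
by apply: eq_bigr => j _; rewrite mnmDE.
Qed.

Lemma hs_weightU (s n : nat) (i : 'I_s) (j : 'I_n.+1) :
  hs_weight U_(hs_index i j)%MM = j.
Proof.
rewrite /hs_weight (bigD1 i) //= (bigD1 j) //= mnm1E eqxx muln1.
rewrite !big1 ?addn0 // => [i' | j'] neq.
  apply: big1 => j' _.
  by rewrite mnm1E eq_hs_index eq_sym (negbTE neq) muln0.
by rewrite mnm1E eq_hs_index eqxx eq_sym (negbTE neq) muln0.
Qed.

Lemma hs_hatU (s n : nat) (i : 'I_s) (j : 'I_n.+1) :
  hs_hat U_(hs_index i j)%MM = U_(i)%MM.
Proof.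
apply/mnmP => i'; rewrite !mnmE (bigD1 j) //= mnm1E eq_hs_index eqxx andbT.
by rewrite big1 ?addn0 // => j' neq; rewrite mnm1E eq_hs_index eq_sym
  [j == j']eq_sym (negbTE neq) andbF.
Qed.

Lemma mderivXU (R : comNzRingType) (n : nat) (i k : 'I_n) :
  ('X_i : {mpoly R[n]})^`M(k) = (i == k)%:R.
Proof.
rewrite mderivX mnm1E; case: eqP => [->|_]; last exact: scale0r.
rewrite (_ : U_(k) - U_(k) = 0)%MM ?mpolyX0 ?scale1r //.
by apply/mnmP => m; rewrite !mnmE subnn.
Qed.

(** The chain rule along the generic arc, read off coefficient by coefficient:
    x_i^(j) enters with T^j, whence the shift by j. *)
Lemma mderiv_HS (K : fieldType) (s n : nat)
    (d : nat -> {mpoly K[s]} -> {mpoly K[s * n.+1]})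
    (d_HS : universal_HS_derivation d) (i : 'I_s) (j : 'I_n.+1) (l : nat)
    (f : {mpoly K[s]}) :
  (l <= n)%N ->
  (d l f)^`M(hs_index i j) = if (j <= l)%N then d (l - j)%N f^`M(i) else 0.
Proof.
case: d_HS => dlin dincl dconst dvar dprod.
have dD m p q : (m <= n)%N -> d m (p + q) = d m p + d m q.
  by move=> le_mn; have := dlin m le_mn 1 p q; rewrite !scale1r.
have dC m c : (m <= n)%N -> d m c%:MP = if m == 0%N then c%:MP else 0.
  by case: m => [|m] le_mn /=; [rewrite dincl comp_mpolyC | rewrite dconst].
have d0 m : (m <= n)%N -> d m 0 = 0.
  by move=> le_mn; rewrite -mpolyC0 dC // mpolyC0 if_same.
have le_subn m k : (m <= n)%N -> (m - k <= n)%N.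
  exact: leq_trans (leq_subr _ _).
elim/mpoly_alg_ind: f l => [c|i'|p q IHp IHq|p q IHp IHq] l le_ln.
- rewrite dC // mderivC d0 ?le_subn // if_same.
  by case: eqP; rewrite ?mderivC ?mderiv0.
- rewrite (dvar (Ordinal (le_ln : (l < n.+1)%N))) !mderivXU eq_hs_index.
  have [_|_] := eqVneq i' i; last by rewrite d0 ?le_subn // if_same.
  (* The derivative of a variable is 1, on which d vanishes except in
     degree 0, that is for l = j. *)
  rewrite -mpolyC1 dC ?le_subn // mpolyC1 -val_eqE /= subn_eq0.
  by case: (ltngtP j l).
- rewrite dD // !mderivD IHp // IHq // dD ?le_subn //.
  by case: ifP; rewrite ?addr0.
have le_ord m (a : 'I_m.+1) : (m <= n)%N -> (a <= n)%N.
  by apply: leq_trans; rewrite -ltnS.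
(* The terms of the Leibniz rule that differentiate the left factor; those
   that differentiate the right factor take this form, with p and q
   exchanged, once the sum is reversed. *)
have half (u v : {mpoly K[s]}) :
    (forall m, (m <= n)%N -> (d m u)^`M(hs_index i j) =
       if (j <= m)%N then d (m - j)%N u^`M(i) else 0) ->
    \sum_(a < l.+1) (d a u)^`M(hs_index i j) * d (l - a)%N v =
    if (j <= l)%N then d (l - j)%N (u^`M(i) * v) else 0.
  move=> IHu; rewrite dprod ?le_subn //.
  rewrite -(sum_shift_mul (fun a => d a u^`M(i)) (fun a => d a v)).
  by apply: eq_bigr => a _; rewrite IHu ?(le_ord l).
rewrite mderivM dD ?le_subn // [p * q^`M(i)]mulrC.
transitivity (\sum_(a < l.+1) (d a p)^`M(hs_index i j) * d (l - a)%N q +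
              \sum_(a < l.+1) (d a q)^`M(hs_index i j) * d (l - a)%N p).
  rewrite dprod // raddf_sum -[X in _ = _ + X](big_mkord xpredT
    (fun a => (d a q)^`M(hs_index i j) * d (l - a)%N p)) big_nat_rev /=.
  rewrite big_mkord -big_split; apply: eq_bigr => a _ /=.
  have le_al : (a <= l)%N by rewrite -ltnS.
  rewrite mderivM add0n subSS subKn //; congr (_ + _); exact: mulrC.
by rewrite !half //; case: ifP; rewrite ?addr0.
Qed.

Theorem proposition4p1 (K : fieldType) (charK0 : [pchar K] =i pred0)
    (s n l : nat) (s_gt0 : (0 < s)%N)
    (d : nat -> {mpoly K[s]} -> {mpoly K[s * n.+1]})
    (d_HS : universal_HS_derivation d)
    (alpha : 'X_{1..s * n.+1}) (le_alpha_l : (hs_weight alpha <= l)%N)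
    (le_l_n : (l <= n)%N) :
  mderivm alpha \o d l =1 d (l - hs_weight alpha)%N \o mderivm (hs_hat alpha).
Proof.
move=> f /=; move deg_alpha: (mdeg alpha) => N.
elim: N => [|N IHN] in alpha l f deg_alpha le_alpha_l le_l_n *.
  move/eqP: deg_alpha; rewrite mdeg_eq0 => /eqP->.
  by rewrite hs_weight0 hs_hat0 !mderivm0m subn0.
have [k alpha_k] : exists k, alpha k != 0%N.
  apply/existsP; apply: contra_eqT deg_alpha.
  rewrite negb_exists => /forallP alpha0.
  suff -> : alpha = 0%MM by rewrite mdeg0.
  by apply/mnmP => k; rewrite mnm0E; apply/eqP/negPn/alpha0.
have : (U_(k) <= alpha)%MM by rewrite lep1mP.
move/submK; rewrite addmC; move: (alpha - U_(k))%MM => beta def_alpha.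
move: deg_alpha le_alpha_l; rewrite -{}def_alpha {alpha alpha_k}.
case/mxvec_indexP: k => i j; rewrite -/(hs_index i j).
rewrite mdegD mdeg1 add1n hs_weightD hs_weightU hs_hatD hs_hatU => -[deg_beta].
move=> le_jbl; have le_jl := leq_trans (leq_addr _ _) le_jbl.
rewrite !mderivmDm !mderivmU1m (mderiv_HS d_HS) // le_jl subnDA.
apply: IHN => //; first by rewrite leq_subRL.
exact: leq_trans (leq_subr _ _) le_l_n.
Qed.
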